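(* For every pGCL program $P$ and every increasing chain $F_1\preceq F_2\preceq\cdots$ in $\mathsf{FPS}$, $$[\![P]\!]\Big(\sup_{n\in\mathbb{N}}F_n\Big)=\sup_{n\in\mathbb{N}}[\![P]\!](F_n).$$
   Context: Fix $k\ge1$ and formal indeterminates $X_1,\dots,X_k$; for $\sigma\in\mathbb{N}^k$, $X^\sigma=X_1^{\sigma_1}\cdots X_k^{\sigma_k}$. $\mathsf{FPS}$ is the set of formal sums $F=\sum_{\sigma\in\mathbb{N}^k}[\sigma]_F X^\sigma$ with $[\sigma]_F\in[0,\infty]$; addition and multiplication by scalars $r\in[0,\infty]$ are coefficient-wise (with $0\cdot\infty=0$). $F\preceq G$ iff $[\sigma]_F\le[\sigma]_G$ for all $\sigma$; suprema are coefficient-wise. For $B\subseteq\mathbb{N}^k$ the restriction is $\langle F\rangle_B=\sum_{\sigma\in B}[\sigma]_F X^\sigma$, and $\neg B=\mathbb{N}^k\setminus B$. pGCL programs over variables $x_1,\dots,x_k$ (ranging over $\mathbb{N}$) are given by $P::=\mathtt{skip}\mid x_i:=E\mid P;P\mid \{P\}[p]\{P\}\mid \mathtt{if}(B)\{P\}\mathtt{else}\{P\}\mid \mathtt{while}(B)\{P\}$, where $E$ is an arithmetic expression with value $\mathrm{eval}_\sigma(E)\in\mathbb{N}$ in state $\sigma$, $p\in[0,1]$, and the guard $B$ is a predicate identified with a subset of $\mathbb{N}^k$. The semantics $[\![P]\!]:\mathsf{FPS}\to\mathsf{FPS}$ is: $[\![\mathtt{skip}]\!](F)=F$; $[\![x_i:=E]\!](F)=\sum_{\sigma}[\sigma]_F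 X_1^{\sigma_1}\cdots X_i^{\mathrm{eval}_\sigma(E)}\cdots X_k^{\sigma_k}$; $[\![\{P_1\}[p]\{P_2\}]\!](F)=p[\![P_1]\!](F)+(1-p)[\![P_2]\!](F)$; $[\![\mathtt{if}(B)\{P_1\}\mathtt{else}\{P_2\}]\!](F)=[\![P_1]\!](\langle F\rangle_B)+[\![P_2]\!](\langle F\rangle_{\neg B})$; $[\![P_1;P_2]\!](F)=[\![P_2]\!]([\![P_1]\!](F))$; $[\![\mathtt{while}(B)\{P\}]\!]$ is the least fixed point, w.r.t. the pointwise order $\sqsubseteq$ on transformers $\mathsf{FPS}\to\mathsf{FPS}$ ($\psi\sqsubseteq\psi'$ iff $\psi(F)\preceq\psi'(F)$ for all $F$), of the unfolding operator $\Phi_{B,P}(\psi)=\lambda F.\ \langle F\rangle_{\neg B}+\psi([\![P]\!](\langle F\rangle_B))$. *)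

(* Defs.v *)
From HB Require Import structures.
From mathcomp Require Import all_boot all_order all_algebra.
From mathcomp Require Import interval_inference.
From mathcomp Require Import mathcomp_extra boolp classical_sets functions.
From mathcomp Require Import reals ereal esum.

Set Implicit Arguments.
Unset Strict Implicit.
Unset Printing Implicit Defensive.
Import Order.TTheory GRing.Theory Num.Theory.

Local Open Scope classical_set_scope.
Local Open Scope ring_scope.
Local Open Scope ereal_scope.

(* A state is also the exponent of a monomial. *)
Definition state (k : nat) := {ffun 'I_k -> nat}.

Definition upd (k : nat) (s : state k) (i : 'I_k) (n : nat) : state k :=
  [ffun j => if j == i then n else s j].

Record fps (R : realType) (k : nat) := FPS {
  coef :> state k -> \bar R;
  coef_ge0 : forall s, 0 <= coef s }.

Section FormalPowerSeries.
Variables (R : realType) (k : nat).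
Implicit Types (F G : fps R k) (B : set (state k)) (s t : state k).

Lemma fps_ext F G : (forall s, F s = G s) -> F = G.
Proof.
case: F G => [f f0] [g g0] /= /funext fg.
by rewrite fg in f0 *; congr FPS; exact: Prop_irrelevance.
Qed.

Definition fps_le F G : Prop := forall s, F s <= G s.

Definition fps_zero : fps R k := @FPS R k (fun=> 0) (fun=> lexx 0).

Definition fps_add F G : fps R k :=
  @FPS R k (fun s => F s + G s)
    (fun s => adde_ge0 (coef_ge0 F s) (coef_ge0 G s)).

Lemma fps_scale_ge0 (r : {nonneg \bar R}) F s : 0 <= r%:num * F s.
Proof. by apply: mule_ge0 => //; exact: coef_ge0. Qed.

Definition fps_scale (r : {nonneg \bar R}) F : fps R k :=
  @FPS R k (fun s => r%:num * F s) (fps_scale_ge0 r F).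

Lemma fps_restr_ge0 B F s : 0 <= if s \in B then F s else 0.
Proof. by case: ifP => // _; exact: coef_ge0. Qed.

Definition fps_restr B F : fps R k :=
  @FPS R k (fun s => if s \in B then F s else 0) (fps_restr_ge0 B F).

Lemma fps_sup_ge0 (F : nat -> fps R k) s :
  0 <= ereal_sup (range (fun n => F n s)).
Proof.
by apply: (le_trans (coef_ge0 (F 0%N) s)); apply: ereal_sup_ubound; exists 0%N.
Qed.

Definition fps_sup (F : nat -> fps R k) : fps R k :=
  @FPS R k (fun s => ereal_sup (range (fun n => F n s))) (fps_sup_ge0 F).

Lemma fps_sup_lub (F : nat -> fps R k) :
  (forall n, fps_le (F n) (fps_sup F)) /\
  (forall G, (forall n, fps_le (F n) G) -> fps_le (fps_sup F) G).
Proof.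
split=> [n s|G FG s]; first by apply: ereal_sup_ubound; exists n.
by apply: ge_ereal_sup => _ [n _ <-]; exact: FG.
Qed.

Lemma fps_monomial_map_ge0 (f : state k -> state k) F t :
  0 <= \esum_(s in [set s | f s = t]) F s.
Proof. by apply: esum_ge0 => s _; exact: coef_ge0. Qed.

(* The formal sum of the [F s] X^(f s) over all s: the coefficient of X^t
   collects the weights of all the states that f sends to t. *)
Definition fps_monomial_map (f : state k -> state k) F : fps R k :=
  @FPS R k (fun t => \esum_(s in [set s | f s = t]) F s)
    (fps_monomial_map_ge0 f F).

Definition transformer := fps R k -> fps R k.

Definition transformer_le (psi psi' : transformer) : Prop :=
  forall F, fps_le (psi F) (psi' F).

Definition is_lfp (Phi : transformer -> transformer) (psi : transformer) :=
  Phi psi = psi /\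
  forall psi', Phi psi' = psi' -> transformer_le psi psi'.

(* The default value for operators without a least fixed point is never used
   in the semantics below, see [sem_while_lfp]. *)
Definition lfp (Phi : transformer -> transformer) : transformer :=
  if pselect (exists psi, is_lfp Phi psi) is left ex then projT1 (cid ex)
  else fun=> fps_zero.

End FormalPowerSeries.

(* Arithmetic expressions are given by their values sigma |-> eval_sigma(E),
   guards by the sets of states satisfying them. *)
Inductive pgcl (R : realType) (k : nat) : Type :=
| Skip
| Assign (i : 'I_k) (E : state k -> nat)
| Seq (P1 P2 : pgcl R k)
| PChoice (P1 : pgcl R k) (p : {i01 R}) (P2 : pgcl R k)
| Ite (B : set (state k)) (P1 P2 : pgcl R k)
| While (B : set (state k)) (P : pgcl R k).

Arguments Skip {R k}.
Arguments Assign {R k} i E.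

Section Semantics.
Variables (R : realType) (k : nat).
Implicit Types (B : set (state k)) (P : pgcl R k) (S : transformer R k).

(* S is the semantics of the loop body *)
Definition unfolding B S (psi : transformer R k) : transformer R k :=
  fun F => fps_add (fps_restr (~` B) F) (psi (S (fps_restr B F))).

Fixpoint sem P : transformer R k :=
  match P with
  | Skip => fun F => F
  | Assign i E => fun F => fps_monomial_map (fun s => upd s i (E s)) F
  | Seq P1 P2 => fun F => sem P2 (sem P1 F)
  | PChoice P1 p P2 => fun F =>
      fps_add (fps_scale (p%:num%:E)%:nng (sem P1 F))
              (fps_scale ((1 - p%:num)%:E)%:nng (sem P2 F))
  | Ite B P1 P2 => fun F =>
      fps_add (sem P1 (fps_restr B F)) (sem P2 (fps_restr (~` B) F))
  | While B P1 => lfp (unfolding B (sem P1))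
  end.

Lemma unfolding_mono B S (psi psi' : transformer R k) :
  transformer_le psi psi' ->
  transformer_le (unfolding B S psi) (unfolding B S psi').
Proof. by move=> le F s; apply: leeD => //; exact: le. Qed.

(* Knaster-Tarski *)
Lemma unfolding_has_lfp B S : exists psi, is_lfp (unfolding B S) psi.
Proof.
pose pre := [set psi | transformer_le (unfolding B S psi) psi].
have ge0 F s : 0 <= ereal_inf [set psi F s | psi in pre].
  by apply: le_ereal_inf_tmp => _ [psi _ <-]; exact: coef_ge0.
pose mu : transformer R k := fun F => @FPS R k _ (ge0 F).
have mu_lb psi : pre psi -> transformer_le mu psi.
  by move=> h F s; apply: ereal_inf_lbound; exists psi.
have pre_mu : pre mu.
  move=> F s; apply: le_ereal_inf_tmp => _ [psi hpsi <-].
  have := @unfolding_mono B S mu psi (mu_lb _ hpsi) F s.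
  by move/le_trans; apply; exact: hpsi.
have post_mu : transformer_le mu (unfolding B S mu).
  exact/mu_lb/unfolding_mono.
exists mu; split.
  apply/funext => F; apply: fps_ext => s; apply/eqP.
  by rewrite eq_le pre_mu post_mu.
by move=> psi' e; apply: mu_lb; rewrite /pre /= e => F s.
Qed.

Lemma sem_while_lfp B P : is_lfp (unfolding B (sem P)) (sem (While B P)).
Proof.
rewrite /= /lfp; case: pselect => [ex|]; first by case: (cid ex).
by case; exact: unfolding_has_lfp.
Qed.

End Semantics.

(* Main.v *)
Require Import Defs.
From mathcomp Require Import all_boot all_order all_algebra.
From mathcomp Require Import interval_inference.
From mathcomp Require Import boolp classical_sets fsbigop.
From mathcomp Require Import reals ereal esum topology normedtype sequences.

(** The transformers preserving suprema of chains are closed under all program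
    constructs, since addition, scaling, restriction and (infinite) summation
    of nonnegative extended reals commute with increasing suprema. For a loop,
    the least fixed point is the supremum of the Kleene iterates of the
    unfolding operator from the zero transformer: this supremum is already a
    fixed point by continuity of addition alone. The iterates preserve suprema
    of chains, and the supremum over the iterates commutes with the supremum
    over the chain. *)

Set Implicit Arguments.
Unset Strict Implicit.
Unset Printing Implicit Defensive.
Import Order.TTheory GRing.Theory Num.Theory.

Local Open Scope classical_set_scope.
Local Open Scope ring_scope.
Local Open Scope ereal_scope.

(** * Suprema of monotone sequences of extended reals *)

Section ErealSup.
Variable R : realType.
Implicit Types u v : nat -> \bar R.

(** A monotone sequence converges to its supremum and limits are unique; so limit laws yield laws
    for suprema. *)
Lemma ereal_sup_cvg u l :
  {homo u : n m / (n <= m)%N >-> n <= m} -> u n @[n --> \oo] --> l ->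
  ereal_sup (range u) = l.
Proof.
move=> /ereal_nondecreasing_cvgn ucvg ul.
exact: cvg_unique (@ereal_hausdorff R) _ _ _ _ ucvg ul.
Qed.

(** Additivity of limits applies, as nonnegativity excludes an indeterminate sum of opposite
    infinities. *)
Lemma ereal_sup_rangeD u v :
  {homo u : n m / (n <= m)%N >-> n <= m} ->
  {homo v : n m / (n <= m)%N >-> n <= m} ->
  (forall n, 0 <= u n) -> (forall n, 0 <= v n) ->
  ereal_sup (range (fun n => u n + v n)) =
  ereal_sup (range u) + ereal_sup (range v).
Proof.
move=> und vnd u0 v0; apply: ereal_sup_cvg.
  by move=> n m nm; apply: leeD; [exact: und|exact: vnd].
apply: cvgeD; [|exact: ereal_nondecreasing_cvgn..].
have sup0 (w : nat -> \bar R) : (forall n, 0 <= w n) -> 0 <= ereal_sup (range w).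
  by move=> w0; apply: (le_trans (w0 0%N)); apply: ereal_sup_ubound; exists 0%N.
by rewrite ge0_adde_def// inE sup0.
Qed.

Lemma ereal_sup_rangeZ u (r : \bar R) :
  {homo u : n m / (n <= m)%N >-> n <= m} -> 0 <= r -> r \is a fin_num ->
  ereal_sup (range (fun n => r * u n)) = r * ereal_sup (range u).
Proof.
move=> und r0 rfin; apply: ereal_sup_cvg.
  by move=> n m nm; apply: lee_wpmul2l => //; exact: und.
by apply: cvgeZl => //; exact: ereal_nondecreasing_cvgn.
Qed.

(** Monotone convergence for the counting measure on [A]. *)
Lemma esum_ereal_sup_range (T : choiceType) (A : set T) (f : nat -> T -> \bar R) :
  (forall n t, 0 <= f n t) ->
  (forall t, {homo f^~ t : n m / (n <= m)%N >-> n <= m}) ->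
  ereal_sup (range (fun n => \esum_(t in A) f n t)) =
  \esum_(t in A) ereal_sup (range (f^~ t)).
Proof.
move=> f0 fnd; apply/eqP; rewrite eq_le; apply/andP; split.
  apply: ge_ereal_sup => _ [n _ <-]; apply: le_esum => t _.
  by apply: ereal_sup_ubound; exists n.
(* [\esum] is a supremum of finite sums, so it suffices to bound the sum over each finite [X] inside
   [A]; finite sums commute with limits. *)
apply: ge_ereal_sup => _ [X [finX XA] <-].
have fsnd : {homo (fun n => \sum_(t \in X) f n t) : n m / (n <= m)%N >-> n <= m}.
  by move=> n m nm; apply: lee_fsum => // t _; exact: fnd.
have /(ereal_sup_cvg fsnd) <- : (\sum_(t \in X) f n t) @[n --> \oo] -->
    \sum_(t \in X) ereal_sup (range (f^~ t)).
  under eq_cvg do rewrite fsbig_finite//.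
  rewrite fsbig_finite//; apply: cvg_nnesum => t _.
    by apply: nearW => n; exact: f0.
  exact: ereal_nondecreasing_cvgn.
apply: ge_ereal_sup => _ [n _ <-].
apply: (@le_trans _ _ (\esum_(t in A) f n t)).
  by apply: ereal_sup_ubound; exists X.
by apply: ereal_sup_ubound; exists n.
Qed.

End ErealSup.

(** * Sup-preserving transformers of formal power series *)

Section Continuity.
Variables (R : realType) (k : nat).
Implicit Types (F G : nat -> fps R k) (S : transformer R k) (X Y Z : fps R k).
Implicit Types (B : set (state k)).

Definition fps_chain F := forall n, fps_le (F n) (F n.+1).

Definition preserves_sup S := forall F, fps_chain F ->
  S (fps_sup F) = fps_sup (fun n => S (F n)).

Lemma fps_lexx X : fps_le X X.
Proof. by move=> s. Qed.

Lemma fps_le_trans Y X Z : fps_le X Y -> fps_le Y Z -> fps_le X Z.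
Proof. by move=> XY YZ s; exact: le_trans (XY s) (YZ s). Qed.

Lemma fps_le_anti X Y : fps_le X Y -> fps_le Y X -> X = Y.
Proof. by move=> XY YX; apply: fps_ext => s; apply: le_anti; rewrite XY YX. Qed.

Lemma fps_sup_ub F n : fps_le (F n) (fps_sup F).
Proof. exact: (fps_sup_lub F).1. Qed.

Lemma fps_sup_le F X : (forall n, fps_le (F n) X) -> fps_le (fps_sup F) X.
Proof. exact: (fps_sup_lub F).2. Qed.

(** Both sides are the least upper bound of the whole doubly indexed family. *)
Lemma fps_sup_exchange (F : nat -> nat -> fps R k) :
  fps_sup (fun m => fps_sup (F m)) = fps_sup (fun n => fps_sup (F^~ n)).
Proof.
apply: fps_le_anti; apply: fps_sup_le => m; apply: fps_sup_le => n.
- apply: fps_le_trans (fps_sup_ub (fun n => fps_sup (F^~ n)) n).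
  exact: (fps_sup_ub (F^~ n)).
- apply: fps_le_trans (fps_sup_ub (fun m => fps_sup (F m)) n).
  exact: (fps_sup_ub (F n)).
Qed.

Lemma fps_chain_homo F s :
  fps_chain F -> {homo (fun n => F n s) : n m / (n <= m)%N >-> n <= m}.
Proof.
by move=> Fc; apply: homo_leq => [//|y x z|n]; [exact: le_trans|exact: Fc].
Qed.

Lemma fps_sup_add F G : fps_chain F -> fps_chain G ->
  fps_sup (fun n => fps_add (F n) (G n)) = fps_add (fps_sup F) (fps_sup G).
Proof.
move=> Fc Gc; apply: fps_ext => s; apply: ereal_sup_rangeD.
- exact: fps_chain_homo.
- exact: fps_chain_homo.
- by move=> n; exact: coef_ge0.
- by move=> n; exact: coef_ge0.
Qed.

Lemma fps_sup_const X : fps_sup (fun=> X) = X.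
Proof.
apply: fps_le_anti; last exact: fps_sup_ub (fun=> X) 0%N.
by apply: fps_sup_le => _; exact: fps_lexx.
Qed.

Lemma preserves_sup_mono S X Y :
  preserves_sup S -> fps_le X Y -> fps_le (S X) (S Y).
Proof.
(* Monotonicity comes from continuity on the chain [X], [Y], [Y], ..., whose supremum is [Y]. *)
move=> Sc XY; pose F n := if n is 0%N then X else Y.
have supF : fps_sup F = Y.
  apply: fps_le_anti; last exact: fps_sup_ub F 1%N.
  by apply: fps_sup_le => -[|n] //; exact: fps_lexx.
rewrite -[in S Y]supF Sc; first exact: fps_sup_ub (fun n => S (F n)) 0%N.
by case=> [|n] //; exact: fps_lexx.
Qed.

Lemma preserves_sup_chain S F :
  preserves_sup S -> fps_chain F -> fps_chain (fun n => S (F n)).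
Proof. by move=> Sc Fc n; exact: preserves_sup_mono. Qed.

Lemma preserves_sup_comp S S' : preserves_sup S -> preserves_sup S' ->
  preserves_sup (fun X => S' (S X)).
Proof.
by move=> Sc S'c F Fc; rewrite Sc// S'c//; exact: preserves_sup_chain.
Qed.

Lemma preserves_sup_add S S' : preserves_sup S -> preserves_sup S' ->
  preserves_sup (fun X => fps_add (S X) (S' X)).
Proof.
by move=> Sc S'c F Fc; rewrite Sc// S'c// fps_sup_add//;
  exact: preserves_sup_chain.
Qed.

Lemma preserves_sup_restr B : preserves_sup (fps_restr B).
Proof.
move=> F Fc; apply: fps_ext => s /=; case: ifP => // _.
(* Outside [B], the right-hand side is the supremum of a constant zero sequence. *)
by rewrite -[RHS]/(fps_sup (fun=> fps_zero R k) s) fps_sup_const.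
Qed.

Lemma preserves_sup_scale (r : {nonneg \bar R}) :
  r%:num \is a fin_num -> preserves_sup (@fps_scale R k r).
Proof.
move=> rfin F Fc; apply: fps_ext => s /=; rewrite ereal_sup_rangeZ//.
exact: fps_chain_homo.
Qed.

Lemma preserves_sup_monomial_map (f : state k -> state k) :
  preserves_sup (fps_monomial_map f).
Proof.
move=> F Fc; apply: fps_ext => t /=; rewrite esum_ereal_sup_range//.
  by move=> n s; exact: coef_ge0.
by move=> s; exact: fps_chain_homo.
Qed.

Lemma preserves_sup_unfolding B S S' : preserves_sup S -> preserves_sup S' ->
  preserves_sup (unfolding B S S').
Proof.
move=> Sc S'c; apply: preserves_sup_add; first exact: preserves_sup_restr.
apply: preserves_sup_comp S'c; apply: preserves_sup_comp Sc.
exact: preserves_sup_restr.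
Qed.

(** [unfolding B S psi] uses [psi] only through its value at a single series, and suprema of
    transformers are pointwise; hence only the addition has to commute with the supremum of the
    iterates. *)
Lemma unfolding_lfp_sup B S S' : is_lfp (unfolding B S) S' ->
  S' = fun X => fps_sup (fun n => iter n (unfolding B S) (fun=> fps_zero R k) X).
Proof.
pose Phi := unfolding B S.
pose K n : transformer R k := iter n Phi (fun=> fps_zero R k).
move=> [S'fix S'le]; apply/funext => X.
have Kchain n : transformer_le (K n) (K n.+1).
  elim: n => [|n IHn]; first by move=> ? ?; exact: coef_ge0.
  exact: unfolding_mono.
have KS' n : transformer_le (K n) S'.
  elim: n => [|n IHn]; first by move=> ? ?; exact: coef_ge0.
  by rewrite -S'fix; exact: unfolding_mono.
apply: fps_le_anti; last by apply: fps_sup_le => n; exact: KS'.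
(* Since [S'] is least, it remains to show that the supremum of the iterates is a fixed point. *)
apply: (S'le (fun X => fps_sup (K^~ X))).
apply/funext => Y; rewrite /Phi /unfolding -[fps_restr (~` B) Y]fps_sup_const.
rewrite -fps_sup_add//; first last.
- by move=> n; exact: Kchain.
- by move=> n; exact: fps_lexx.
(* The two sequences differ by a shift: the left one starts at [K 1], and the extra term [K 0] on
   the right is zero. *)
apply: fps_le_anti; apply: fps_sup_le => n.
  exact: (fps_sup_ub (K^~ Y) n.+1).
case: n => [|n]; first by move=> ?; exact: coef_ge0.
exact: (fps_sup_ub (fun n => Phi (K n) Y) n).
Qed.

Lemma preserves_sup_unfolding_lfp B S S' :
  preserves_sup S -> is_lfp (unfolding B S) S' -> preserves_sup S'.
Proof.
move=> Sc /unfolding_lfp_sup -> F Fc.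
have Kc n : preserves_sup (iter n (unfolding B S) (fun=> fps_zero R k)).
  elim: n => [|n IHn]; last exact: preserves_sup_unfolding.
  by move=> G _ /=; rewrite fps_sup_const.
(* The exchange makes the iterate index outermost on both sides, so the claim reduces to [Kc] for
   each iterate. *)
by rewrite fps_sup_exchange; congr fps_sup; apply/funext => n; exact: Kc.
Qed.

Lemma preserves_sup_sem (P : pgcl R k) : preserves_sup (sem P).
Proof.
elim: P => [|i E|P1 IH1 P2 IH2|P1 IH1 p P2 IH2|B P1 IH1 P2 IH2|B P IH].
- by [].
- exact: preserves_sup_monomial_map.
- exact: preserves_sup_comp.
- apply: preserves_sup_add.
    (* The weights [p] and [1 - p] are embedded reals, hence finite. *)
    by apply: preserves_sup_comp IH1 _; exact: preserves_sup_scale.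
  by apply: preserves_sup_comp IH2 _; exact: preserves_sup_scale.
- apply: preserves_sup_add.
    by apply: preserves_sup_comp IH1; exact: preserves_sup_restr.
  by apply: preserves_sup_comp IH2; exact: preserves_sup_restr.
- exact: preserves_sup_unfolding_lfp IH (sem_while_lfp B P).
Qed.

End Continuity.

Theorem theorem1 (R : realType) (k : nat) (hk : (1 <= k)%N)
    (P : pgcl R k) (F : nat -> fps R k)
    (hF : forall n : nat, fps_le (F n) (F n.+1)) :
  sem P (fps_sup F) = fps_sup (fun n => sem P (F n)).
Proof. exact: preserves_sup_sem. Qed.
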